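(* Let $G$ be a graph with an independent set $C$. Then $\alpha(G)=\Theta(G)=\vartheta(G)=|C|$ if $C$ satisfies one of the following conditions: (1) every vertex not in $C$ is adjacent to exactly $\lambda>-\tau$ vertices of $C$, where $\tau$ is the minimum adjacency eigenvalue of $G$; (2) $G$ is regular and every vertex not in $C$ is adjacent to exactly $-\tau$ vertices of $C$, where $\tau<0$ is the minimum adjacency eigenvalue of $G$; (3) $d_u=\delta(G)$ for each $u\in C$, and every vertex not in $C$ is adjacent to exactly $\mu-\delta(G)$ vertices of $C$, where $\mu>0$ is the largest Laplacian eigenvalue of $G$; (4) $d_u=\delta(G)>0$ for each $u\in C$, and every vertex $v$ not in $C$ is adjacent to exactly $(\mu-1)d_v$ vertices of $C$, where $\mu$ is the largest normalized Laplacian eigenvalue of $G$; (5) every vertex not in $C$ is adjacent to all vertices of $C$, and $2|C|\ge|V(G)|-\delta(G-C)$; (6) $G$ has a spanning subgraph $H$ with $\delta(H)>0$ which is semiregular bipartite with parameters $(n_1,n_2,r_1,r_2)$, $n_1\le n_2$, and $C$ is the color class with $n_2$ vertices in $H$; (7) there is a clique covering $\varepsilon$ of $G$ such that $d_v^\varepsilon=\min_{u\in V(G)}d_u^\varepsilon>0$ for each $v\in C$, and $|C\cap Q|=1$ for each $Q\in\varepsilon$; (8) there is a uniform hypergraph $H$ such that $G=\Omega(H)$ and $C$ corresponds to a perfect matching of $H$.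
   Context: $\alpha(G)$ is the independence number, $d_u$ the degree of $u$, $\delta(G)$ the minimum degree, $G-C$ the graph obtained by deleting $C$. $\Theta(G)=\lim_k\alpha(G^k)^{1/k}$ is the Shannon capacity with $G^k$ the strong power (vertex set $V^k$, distinct tuples adjacent iff in each coordinate they are equal or adjacent). $\vartheta(G)$ is the Lovász theta function: the minimum largest eigenvalue of a real symmetric matrix indexed by $V(G)$ with entry $1$ whenever $i=j$ or $i,j$ are nonadjacent. The Laplacian is $D-A$ ($D$ the degree diagonal matrix, $A$ the adjacency matrix). The normalized Laplacian (for graphs without isolated vertices) has diagonal entries $1$, entries $-(d_id_j)^{-1/2}$ for edges $\{i,j\}$, and $0$ otherwise. A bipartite graph is semiregular with parameters $(n_1,n_2,r_1,r_2)$ if its color classes have sizes $n_1,n_2$ and all vertices in the class of size $n_i$ have degree $r_i$. A clique covering $\varepsilon$ is a set of cliques of $G$ such that every edge lies in at least one of them; $d_u^\varepsilon$ is the number of cliques of $\varepsilon$ containing $u$. A hypergraph is uniform if all edges have the same size; its intersection graph $\Omega(H)$ has vertex set $E(H)$, two edges adjacent iff they intersect; a perfect matching is a set of pairwise disjoint edges covering all vertices. *)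

(* Defs.v *)
From HB Require Import structures.
From mathcomp Require Import classical_sets.
From mathcomp Require Import all_boot all_order all_algebra.
From mathcomp Require Import reals topology normedtype sequences exp.

Set Implicit Arguments.
Unset Strict Implicit.
Unset Printing Implicit Defensive.

Import Order.TTheory GRing.Theory Num.Theory.
Import numFieldNormedType.Exports.

Local Open Scope ring_scope.

Record graph (V : finType) := Graph {
  adj : rel V;
  adj_sym : symmetric adj;
  adj_irr : irreflexive adj
}.

Section Graphs.
Variable V : finType.
Implicit Types (G H : graph V) (C S Q : {set V}) (v : V).

Definition nbrs_in G S v : nat := #|[set u in S | adj G v u]|.

Definition degree G v : nat := #|[set u | adj G v u]|.

(* Degrees are smaller than #|V|, so the default value #|V| is harmless when V
   is nonempty; on the graph without vertices the result is 0. *)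
Definition min_degree G : nat := \big[minn/#|V|]_(v : V) degree G v.

Definition regular G : Prop := exists d : nat, forall v, degree G v = d.

Definition independent G S : bool :=
  [forall u in S, forall v in S, ~~ adj G u v].

Definition alpha G : nat := \max_(S : {set V} | independent G S) #|S|.

Definition clique G Q : bool :=
  [forall u in Q, forall v in Q, (u != v) ==> adj G u v].

Definition clique_covering G (eps : {set {set V}}) : Prop :=
  (forall Q, Q \in eps -> clique G Q) /\
  (forall u v, adj G u v -> exists2 Q, Q \in eps & (u \in Q) && (v \in Q)).

Definition cover_degree (eps : {set {set V}}) v : nat :=
  #|[set Q in eps | v \in Q]|.

(* As for min_degree, the default value bounds all the terms. *)
Definition min_cover_degree (eps : {set {set V}}) : nat :=
  \big[minn/#|eps|]_(v : V) cover_degree eps v.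

Definition spanning_subgraph H G : Prop := subrel (adj H) (adj G).

Definition semiregular_bipartite H (V1 V2 : {set V}) (n1 n2 r1 r2 : nat) :
    Prop :=
  [/\ V1 :|: V2 = [set: V] /\ [disjoint V1 & V2],
      independent H V1 /\ independent H V2,
      #|V1| = n1 /\ #|V2| = n2,
      forall v, v \in V1 -> degree H v = r1
    & forall v, v \in V2 -> degree H v = r2].

End Graphs.

Definition graph_iso (V W : finType) (G : graph V) (H : graph W) (f : V -> W) :
    Prop :=
  bijective f /\ (forall u v, adj H (f u) (f v) = adj G u v).

Section Induced.
Variables (V : finType) (G : graph V) (S : {set V}).

Definition induced_rel : rel {v : V | v \in S} :=
  fun u v => adj G (val u) (val v).

Lemma induced_sym : symmetric induced_rel.
Proof. by move=> u v; rewrite /induced_rel adj_sym. Qed.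

Lemma induced_irr : irreflexive induced_rel.
Proof. by move=> u; rewrite /induced_rel adj_irr. Qed.

Definition induced : graph {v : V | v \in S} := Graph induced_sym induced_irr.

End Induced.

Definition delete (V : finType) (G : graph V) (C : {set V}) := induced G (~: C).

Section StrongPower.
Variables (V : finType) (G : graph V) (k : nat).

Definition strong_power_rel : rel {ffun 'I_k -> V} :=
  fun x y => (x != y) && [forall i, (x i == y i) || adj G (x i) (y i)].

Lemma strong_power_sym : symmetric strong_power_rel.
Proof.
move=> x y; rewrite /strong_power_rel eq_sym; congr (_ && _).
by apply: eq_forallb => i; rewrite eq_sym adj_sym.
Qed.

Lemma strong_power_irr : irreflexive strong_power_rel.
Proof. by move=> x; rewrite /strong_power_rel eqxx. Qed.

Definition strong_power : graph {ffun 'I_k -> V} :=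
  Graph strong_power_sym strong_power_irr.

End StrongPower.

Record hypergraph (W : finType) := Hypergraph {
  hedges : {set {set W}};
  hedges_nonempty : set0 \notin hedges
}.

Section Hypergraphs.
Variables (W : finType) (H : hypergraph W).

Definition uniform : Prop :=
  exists r : nat, forall e, e \in hedges H -> #|e| = r.

Definition intersection_rel : rel {e : {set W} | e \in hedges H} :=
  fun e f => (e != f) && (val e :&: val f != set0).

Lemma intersection_sym : symmetric intersection_rel.
Proof. by move=> e f; rewrite /intersection_rel eq_sym setIC. Qed.

Lemma intersection_irr : irreflexive intersection_rel.
Proof. by move=> e; rewrite /intersection_rel eqxx. Qed.

Definition intersection_graph : graph {e : {set W} | e \in hedges H} :=
  Graph intersection_sym intersection_irr.

Definition perfect_matching (M : {set {set W}}) : Prop :=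
  [/\ M \subset hedges H, trivIset M & cover M = [set: W]].

End Hypergraphs.

Section Spectra.
Variable R : realType.

(* Eigenvalues are taken in R, which is no restriction for the real symmetric
   matrices considered below. *)
Definition max_eigenvalue (n : nat) (A : 'M[R]_n) (m : R) : Prop :=
  eigenvalue A m /\ (forall a : R, eigenvalue A a -> a <= m).

Definition min_eigenvalue (n : nat) (A : 'M[R]_n) (m : R) : Prop :=
  eigenvalue A m /\ (forall a : R, eigenvalue A a -> m <= a).

Variables (V : finType) (G : graph V).

(* Matrices indexed by V have rows and columns in 'I_#|V|, the index i
   standing for the vertex enum_val i. *)
Definition adjacency_mx : 'M[R]_#|V| :=
  \matrix_(i, j) (adj G (enum_val i) (enum_val j))%:R.

Definition degree_mx : 'M[R]_#|V| :=
  diag_mx (\row_i (degree G (enum_val i))%:R).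

Definition laplacian_mx : 'M[R]_#|V| := degree_mx - adjacency_mx.

Definition normalized_laplacian_mx : 'M[R]_#|V| :=
  \matrix_(i, j)
    if i == j then 1
    else if adj G (enum_val i) (enum_val j) then
      - (Num.sqrt ((degree G (enum_val i))%:R * (degree G (enum_val j))%:R))^-1
    else 0.

Definition lovasz_feasible (A : 'M[R]_#|V|) : Prop :=
  A^T = A /\
  (forall i j, (i == j) || ~~ adj G (enum_val i) (enum_val j) -> A i j = 1).

(* t is the Lovasz theta function of G: the minimum is attained at t. *)
Definition is_lovasz_theta (t : R) : Prop :=
  (exists2 A, lovasz_feasible A & max_eigenvalue A t) /\
  (forall A m, lovasz_feasible A -> max_eigenvalue A m -> t <= m).

(* t is the Shannon capacity of G: the limit exists and equals t. *)
Definition is_shannon_capacity (t : R) : Prop :=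
  ((fun k : nat => (alpha (strong_power G k))%:R `^ (k%:R^-1) : R)
     @ \oo --> t)%classic.

End Spectra.

(* Main.v *)
(* A Gram matrix B of vectors indexed by V with B >= J, diagonal at most t and
   zeros at distinct nonadjacent pairs bounds alpha(G), and tensor powers of B
   bound alpha(G^k) by t^k; from B one also reads off a matrix feasible for
   theta(G) with largest eigenvalue at most t.  When t = |C| for an independent
   set C, all the parameters are squeezed onto |C|.
   Such a B is (|C|/c) P for any positive semidefinite P vanishing at distinct
   nonadjacent pairs, with diagonal at most c and with P 1_C = c 1: projecting
   the Gram vectors of P away from the sum over C shows P >= (c/|C|) J.  For the
   adjacency matrix A, the degree matrix D and n = |V|, conditions (1)-(6) use
     (1), (2)  A + lambda I                     with c = lambda,
     (3)       mu I - D + A                     with c = mu - delta,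
     (4)       D^-1 ((mu - 1) D + A) D^-1       with c = (mu - 1) / delta,
     (5)       as (3) with n for mu, n I - J being the Laplacian of K_n,
     (6)       as (4) for H with mu = 2 (the signless Laplacian of H),
   and (7), (8) use D^-1 N N^T D^-1, where N is the incidence matrix of vertices
   against cliques (the points of the hypergraph in (8)) and D the diagonal of
   N N^T. *)

Require Import Defs.
From HB Require Import structures.
From mathcomp Require Import classical_sets.
From mathcomp Require Import all_boot all_order all_algebra.
From mathcomp Require Import reals topology normedtype sequences exp.
From mathcomp Require Import spectral complex ring lra zify.

Set Implicit Arguments.
Unset Strict Implicit.
Unset Printing Implicit Defensive.

Import Order.TTheory GRing.Theory Num.Theory.
Import numFieldNormedType.Exports.

Local Open Scope ring_scope.

(** * Spectral decomposition of real symmetric matrices *)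

(** Over the complex numbers the matrix is Hermitian, hence unitarily diagonalizable with real
    spectrum; [g] and [h] are the real and imaginary parts of the rows of the unitary matrix, and
    both identities are real parts of complex ones. *)
Lemma spectral_decomposition (R : rcfType) n (A : 'M[R]_n) : A^T = A ->
  exists (d : 'I_n -> R) (g h : 'I_n -> 'I_n -> R),
    [/\ forall i, eigenvalue A (d i),
        forall u v, A u v = \sum_i d i * (g i u * g i v + h i u * h i v)
      & forall u v, (u == v)%:R = \sum_i (g i u * g i v + h i u * h i v)].
Proof.
move=> Asym; pose f := real_complex R : {rmorphism R -> complex R}.
pose B := map_mx f A.
have Bherm : B \is hermsymmx.
  apply: realsym_hermsym.
    apply/is_hermitianmxP; rewrite expr0 scale1r map_mx_id //.
    by rewrite /B map_trmx Asym.
  apply/mxOverP => i j; rewrite mxE; apply/complex_realP; by exists (A i j).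
have Breal := hermitian_spectral_diag_real Bherm.
have /orthomx_spectralP := hermitian_normalmx Bherm.
have := spectral_unitarymx B.
move: (spectralmx B) (spectral_diag B) Breal => P d dreal Pu BE.
have dR i : d 0 i = f (complex.Re (d 0 i)).
  by rewrite [RHS]RRe_real //; apply: (mxOverP dreal).
have PV : invmx P = map_mx Num.conj P^T by rewrite invmx_unitary.
have PP : map_mx Num.conj P^T *m P = 1%:M by rewrite -PV mulVmx // unitarymx_unit.
exists (fun i => complex.Re (d 0 i)), (fun i u => complex.Re (P i u)),
  (fun i u => complex.Im (P i u)).
split.
- move=> i; rewrite -(eigenvalue_map f) -dR -/B.
  apply/eigenvalueP; exists (row i P).
    rewrite -row_mul BE !mulmxA mulmxV ?unitarymx_unit // mul1mx.
    apply/rowP => j; rewrite !mxE; under eq_bigr do rewrite !mxE.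
    rewrite (bigD1 i) //= eqxx mulr1n big1 ?addr0 // => k /negPf ki.
    by rewrite eq_sym ki mulr0n mul0r.
  apply/eqP => /(congr1 (mulmx^~ (invmx P))); rewrite -row_mul.
  rewrite mulmxV ?unitarymx_unit // mul0mx.
  move/rowP => /(_ i); rewrite !mxE eqxx => /eqP; by rewrite oner_eq0.
- move=> u v.
  have /matrixP/(_ u v)/(congr1 (@complex.Re R)) := BE.
  rewrite PV mxE /= => ->; rewrite mxE raddf_sum; apply: eq_bigr => i _.
  rewrite mul_mx_diag !mxE dR.
  by case: (P i u) (P i v) => a b [a' b'] /=; ring.
- move=> u v.
  have /matrixP/(_ u v)/(congr1 (@complex.Re R)) := PP.
  rewrite !mxE raddf_sum => E.
  transitivity (complex.Re ((u == v)%:R : complex R)); first by case: eqP.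
  rewrite -[LHS]E; apply: eq_bigr => i _.
  rewrite !mxE.
  by case: (P i u) (P i v) => a b [a' b'] /=; ring.
Qed.

(** * Independent sets and the independence number *)

Lemma alpha_le (V : finType) (G : graph V) (n : nat) :
  (forall S : {set V}, independent G S -> #|S| <= n)%N -> (alpha G <= n)%N.
Proof. by move=> H; apply/bigmax_leqP. Qed.

Lemma leq_alpha (V : finType) (G : graph V) (S : {set V}) :
  independent G S -> (#|S| <= alpha G)%N.
Proof.
move=> H.
exact: (@leq_bigmax_cond _ (independent G) (fun S : {set V} => #|S|)).
Qed.

Lemma independentP (V : finType) (G : graph V) (S : {set V}) :
  reflect (forall u v, u \in S -> v \in S -> ~~ adj G u v) (independent G S).
Proof.
apply: (iffP forall_inP) => [H u v uS vS|H u uS]; first exact: (forall_inP (H u uS)).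
by apply/forall_inP => v vS; apply: H.
Qed.

(** * Quadratic forms and positive semidefiniteness *)

Section QuadraticForms.
Variables (R : rcfType) (T : finType).
Implicit Types (P : T -> T -> R) (x : T -> R).

Definition qform P x : R := \sum_u \sum_v P u v * (x u * x v).

Definition psd P : Prop := forall x, 0 <= qform P x.

Lemma sqr_sum x : (\sum_u x u) ^+ 2 = \sum_u \sum_v x u * x v.
Proof.
by rewrite expr2 mulr_suml; apply: eq_bigr => u _; rewrite mulr_sumr.
Qed.

Lemma qform_gram (I : finType) (g : I -> T -> R) (a : I -> R) x :
  qform (fun u v => \sum_i a i * (g i u * g i v)) x
  = \sum_i a i * (\sum_u g i u * x u) ^+ 2.
Proof.
rewrite /qform.
under eq_bigr => u _ do under eq_bigr => v _ do rewrite mulr_suml.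
under eq_bigr => u _ do rewrite exchange_big /=.
rewrite exchange_big /=; apply: eq_bigr => i _.
rewrite sqr_sum mulr_sumr; apply: eq_bigr => u _.
by rewrite mulr_sumr; apply: eq_bigr => v _; ring.
Qed.

Lemma eq_qform P Q x : P =2 Q -> qform P x = qform Q x.
Proof. by move=> H; apply: eq_bigr => u _; apply: eq_bigr => v _; rewrite H. Qed.

Lemma qformD P Q x :
  qform (fun u v => P u v + Q u v) x = qform P x + qform Q x.
Proof.
rewrite -big_split; apply: eq_bigr => u _; rewrite -big_split.
by apply: eq_bigr => v _ /=; rewrite mulrDl.
Qed.

Lemma qformZ (a : R) P x : qform (fun u v => a * P u v) x = a * qform P x.
Proof.
rewrite mulr_sumr; apply: eq_bigr => u _; rewrite mulr_sumr.
by apply: eq_bigr => v _; rewrite -mulrA.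
Qed.

Lemma qform_diag (e : T -> R) x :
  qform (fun u v => (u == v)%:R * e u) x = \sum_u e u * x u ^+ 2.
Proof.
apply: eq_bigr => u _; rewrite (bigD1 u) //= eqxx mul1r big1 ?addr0 -?expr2 //.
by move=> v; rewrite eq_sym => /negPf->; rewrite !mul0r.
Qed.

Lemma qform_delta P v : qform P (fun u => (u == v)%:R) = P v v.
Proof.
rewrite /qform (bigD1 v) //= (bigD1 v) //= eqxx !mulr1 !big1 ?addr0 //.
- by move=> u /negPf->; rewrite big1 // => w _; rewrite mul0r mulr0.
- by move=> u /negPf->; rewrite !mulr0.
Qed.

Lemma psd_diag_ge0 P v : psd P -> 0 <= P v v.
Proof. by move=> H; rewrite -qform_delta; apply: H. Qed.

Lemma psd_scale P (s : T -> R) : psd P -> psd (fun u v => s u * s v * P u v).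
Proof.
move=> H x; rewrite (_ : qform _ _ = qform P (fun u => s u * x u)); first exact: H.
by apply: eq_bigr => u _; apply: eq_bigr => v _; ring.
Qed.

End QuadraticForms.

(** * Rayleigh quotients, Gram vectors and extreme eigenvalues *)

Section SymmetricMatrices.
Variable R : rcfType.

Lemma qform_enum (V : finType) (P : V -> V -> R) (x : V -> R) :
  qform P x = qform (fun i j : 'I_#|V| => P (enum_val i) (enum_val j))
                    (fun i => x (enum_val i)).
Proof.
have E (F : V -> R) : \sum_v F v = \sum_(i < #|V|) F (enum_val i).
  by rewrite (reindex _ (onW_bij _ (@enum_val_bij V))).
by rewrite /qform E; apply: eq_bigr => i _; rewrite E.
Qed.

Lemma qform_eigenvector n (A : 'M[R]_n) a (w : 'rV_n) :
  w *m A = a *: w -> qform A (w 0) = a * \sum_i w 0 i ^+ 2.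
Proof.
move=> E; rewrite /qform exchange_big mulr_sumr; apply: eq_bigr => j _ /=.
have /rowP/(_ j) := E; rewrite !mxE expr2 mulrA => <-.
by rewrite mulr_suml; apply: eq_bigr => i _; ring.
Qed.

Lemma sum_sqr_gt0 n (w : 'rV[R]_n) : w != 0 -> 0 < \sum_i w 0 i ^+ 2.
Proof.
move=> w0; rewrite lt_def sumr_ge0 ?andbT => [|i _]; last exact: sqr_ge0.
apply: contra w0; rewrite psumr_eq0 => [/allP H|i _]; last exact: sqr_ge0.
apply/eqP/rowP => i; rewrite mxE; apply/eqP.
by have := H i (mem_index_enum _); rewrite sqrf_eq0.
Qed.

(** The weight [e i] is the squared modulus of the inner product of [x] with the [i]-th complex
    eigenvector, so bounds on the eigenvalues become bounds on the form. *)
Lemma rayleigh n (A : 'M[R]_n) x : A^T = A ->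
  exists (d e : 'I_n -> R),
    [/\ forall i, eigenvalue A (d i), forall i, 0 <= e i,
        qform A x = \sum_i d i * e i & \sum_i x i ^+ 2 = \sum_i e i].
Proof.
move=> /spectral_decomposition[d [g [h [dA AE IE]]]].
exists d, (fun i => (\sum_u g i u * x u) ^+ 2 + (\sum_u h i u * x u) ^+ 2).
have E (a : 'I_n -> R) :
    \sum_i a i * ((\sum_u g i u * x u) ^+ 2 + (\sum_u h i u * x u) ^+ 2)
    = qform (fun u v => \sum_i a i * (g i u * g i v + h i u * h i v)) x.
  under eq_bigr do rewrite mulrDr.
  rewrite big_split /= -!qform_gram -qformD; apply: eq_qform => u v.
  by rewrite -big_split; apply: eq_bigr => i _; rewrite mulrDr.
split=> //; first by move=> i; rewrite addr_ge0 ?sqr_ge0.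
  by rewrite E; apply: eq_qform.
have := E (fun=> 1); under eq_bigr do rewrite mul1r.
move->; rewrite -[LHS](eq_bigr _ (fun i _ => mul1r _)) -(qform_diag (fun=> 1)).
by apply: eq_qform => u v; rewrite mulr1 IE; apply: eq_bigr => i _; rewrite mul1r.
Qed.

(** The spectral vectors are scaled by square roots of the eigenvalues; each eigenvalue yields two
    coordinates, one from [g] and one from [h]. *)
Lemma psd_gram (V : finType) (P : V -> V -> R) :
  (forall u v, P u v = P v u) -> psd P ->
  exists (I : finType) (g : I -> V -> R),
    forall u v, P u v = \sum_i g i u * g i v.
Proof.
move=> Psym Ppsd; pose A := \matrix_(i, j < #|V|) P (enum_val i) (enum_val j).
have Asym : A^T = A by apply/matrixP => i j; rewrite !mxE.
have [d [g [h [dA AE _]]]] := spectral_decomposition Asym.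
have d0 i : 0 <= d i.
  have /eigenvalueP[w wE w0] := dA i.
  rewrite -(pmulr_lge0 _ (sum_sqr_gt0 w0)) -(qform_eigenvector wE).
  have := Ppsd (fun u => w 0 (enum_rank u)); rewrite qform_enum.
  congr (_ <= _); apply: eq_bigr => j _; apply: eq_bigr => k _.
  by rewrite !enum_valK mxE.
exists ('I_#|V| + 'I_#|V|)%type, (fun k u => match k with
  | inl i => Num.sqrt (d i) * g i (enum_rank u)
  | inr i => Num.sqrt (d i) * h i (enum_rank u) end) => u v.
have := AE (enum_rank u) (enum_rank v); rewrite mxE !enum_rankK => ->.
rewrite big_sumType /= -big_split; apply: eq_bigr => i _ /=.
by rewrite -{1}(sqr_sqrtr (d0 i)); ring.
Qed.

End SymmetricMatrices.

Section ExtremeEigenvalues.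
Variables (R : realType) (n : nat) (A : 'M[R]_n) (m : R).
Hypothesis Asym : A^T = A.

Lemma max_eigenvalue_psd : max_eigenvalue A m ->
  psd (fun i j => (i == j)%:R * m - A i j).
Proof.
move=> [_ mmax] x.
rewrite (_ : qform _ x = qform (fun i j => (i == j)%:R * m) x
                         + qform (fun i j => -1 * A i j) x); last first.
  by rewrite -qformD; apply: eq_qform => i j; rewrite mulN1r.
rewrite qform_diag qformZ mulN1r -mulr_sumr subr_ge0.
have [d [e [dA e0 -> ->]]] := rayleigh x Asym.
by rewrite mulr_sumr; apply: ler_sum => i _; apply: ler_wpM2r => //; apply: mmax.
Qed.

Lemma min_eigenvalue_psd : min_eigenvalue A m ->
  psd (fun i j => A i j - (i == j)%:R * m).
Proof.
move=> [_ mmin] x.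
rewrite (_ : qform _ x = qform A x
                         + qform (fun i j => (i == j)%:R * - m) x); last first.
  by rewrite -qformD; apply: eq_qform => i j; rewrite mulrN.
rewrite qform_diag -mulr_sumr mulNr subr_ge0.
have [d [e [dA e0 -> ->]]] := rayleigh x Asym.
by rewrite mulr_sumr; apply: ler_sum => i _; apply: ler_wpM2r => //; apply: mmin.
Qed.

End ExtremeEigenvalues.

(** * Dual certificates and their consequences for the three parameters *)

Section Certificates.
Variable R : realType.

(* A feasible point of the dual program: the Gram matrix B of the q-vectors of
   the vertices satisfies B - J >= 0 because the coordinate i0 contributes J. *)
Definition theta_bound (V : finType) (G : graph V) (t : R) : Prop :=
  exists (I : finType) (i0 : I) (q : I -> V -> R),
    [/\ forall v, q i0 v = 1,
        forall v, \sum_i q i v ^+ 2 <= t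
      & forall u v, u != v -> ~~ adj G u v -> \sum_i q i u * q i v = 0].

(** Pythagoras: the vectors of distinct members of an independent set are orthogonal. *)
Lemma sum_sqr_independent (V : finType) (G : graph V) (S : {set V})
    (I : finType) (q : I -> V -> R) : independent G S ->
  (forall u v, u != v -> ~~ adj G u v -> \sum_i q i u * q i v = 0) ->
  \sum_i (\sum_(v in S) q i v) ^+ 2 = \sum_(v in S) \sum_i q i v ^+ 2.
Proof.
move=> /independentP Sind q0.
under eq_bigr => i _ do rewrite expr2 mulr_suml.
rewrite exchange_big; apply: eq_bigr => u uS /=.
under eq_bigr => i _ do rewrite mulr_sumr.
rewrite exchange_big (bigD1 u) //= [X in _ + X]big1 ?addr0 => [|v /andP[vS vu]].
  by apply: eq_bigr => i _; rewrite expr2.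
by rewrite q0 ?Sind // eq_sym.
Qed.

(** The sum of the vectors over [S] has coordinate |S| at [i0] and squared length at most t |S|,
    whence |S|^2 <= t |S|. *)
Lemma theta_bound_independent (V : finType) (G : graph V) t (S : {set V}) :
  0 <= t -> theta_bound G t -> independent G S -> #|S|%:R <= t.
Proof.
move=> t0 [I [i0 [q [q1 qt q0]]]] Sind.
have [->|Sn0] := eqVneq S set0; first by rewrite cards0.
have S0 : 0 < #|S|%:R :> R by rewrite ltr0n card_gt0.
rewrite -(ler_pM2l S0) -expr2.
have -> : #|S|%:R ^+ 2 = (\sum_(v in S) q i0 v) ^+ 2.
  by under eq_bigr do rewrite q1; rewrite sumr_const.
apply: le_trans (_ : \sum_i (\sum_(v in S) q i v) ^+ 2 <= _).
  by rewrite (bigD1 i0) //= lerDl sumr_ge0 // => i _; apply: sqr_ge0.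
rewrite (sum_sqr_independent Sind q0) (le_trans (ler_sum _ (fun v _ => qt v))) //.
by rewrite sumr_const mulr_natl.
Qed.

(** Tensor powers of the vectors serve: distinct nonadjacent tuples have a coordinate with distinct
    nonadjacent entries, and that factor of the inner product vanishes. *)
Lemma theta_bound_strong_power (V : finType) (G : graph V) t k :
  theta_bound G t -> theta_bound (strong_power G k) (t ^+ k).
Proof.
move=> [I [i0 [q [q1 qt q0]]]].
have E (x y : {ffun 'I_k -> V}) :
    \sum_(f : {ffun 'I_k -> I}) (\prod_j q (f j) (x j)) * \prod_j q (f j) (y j)
    = \prod_j \sum_i q i (x j) * q i (y j).
  by rewrite bigA_distr_bigA; apply: eq_bigr => f _; rewrite -big_split.
exists {ffun 'I_k -> I}, [ffun=> i0], 
  (fun (f : {ffun 'I_k -> I}) (x : {ffun 'I_k -> V}) => \prod_j q (f j) (x j)).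
split=> [x|x|x y xy].
- by rewrite big1 // => j _; rewrite ffunE.
- under eq_bigr do rewrite expr2.
  rewrite E -[X in _ <= _ ^+ X]card_ord -prodr_const; apply: ler_prod => j _.
  under eq_bigr do rewrite -expr2.
  by rewrite qt sumr_ge0 // => i _; apply: sqr_ge0.
rewrite /= /strong_power_rel xy /= negb_forall => /existsP[j].
rewrite negb_or => /andP[xyj nadj].
by rewrite E (bigD1 j) //= q0 // mul0r.
Qed.

(** Supplies the lower bound |S|^k for the strong power: inside [S], equal or adjacent means
    equal. *)
Lemma independent_power (V : finType) (G : graph V) (S : {set V}) k :
  independent G S ->
  independent (strong_power G k) [set x in ffun_on (mem S)].
Proof.
move=> /independentP Sind; apply/independentP => x y.
rewrite !inE => /ffun_onP xS /ffun_onP yS.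
rewrite /= /strong_power_rel negb_and negbK -implyNb; apply/implyP => xy.
apply/forallPn => /=; apply/existsP; move: xy; apply: contraR.
rewrite negb_exists => /forallP H; apply/eqP/ffunP => j.
by have := H j; rewrite negbK => /orP[/eqP//|]; rewrite (negPf (Sind _ _ _ _)).
Qed.

Lemma theta_bound_alpha (V : finType) (G : graph V) (C : {set V}) :
  independent G C -> theta_bound G (#|C|%:R : R) -> alpha G = #|C|.
Proof.
move=> Cind B; apply/eqP; rewrite eqn_leq leq_alpha // andbT.
apply: alpha_le => S Sind; rewrite -(ler_nat R).
exact: theta_bound_independent B Sind.
Qed.

Lemma theta_bound_shannon (V : finType) (G : graph V) (C : {set V}) :
  independent G C -> theta_bound G (#|C|%:R : R) ->
  is_shannon_capacity G (#|C|%:R : R).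
Proof.
(* From k = 1 on the sequence is constant; at k = 0 the exponent is the inverse of 0, that is 0, and
   cannot cancel the power k. *)
move=> Cind B; apply: cvg_near_cst; exists 1%N => // k /= k0.
have -> : alpha (strong_power G k) = (#|C| ^ k)%N.
  have card : #|[set x in ffun_on (mem C)] : {set {ffun 'I_k -> V}}| = (#|C| ^ k)%N.
    by rewrite cardsE card_ffun_on card_ord.
  rewrite -card; apply: theta_bound_alpha; first exact: independent_power.
  by rewrite card natrX; apply: theta_bound_strong_power.
rewrite natrX -powR_mulrn // -powRrM mulfV ?powRr1 // pnatr_eq0.
by rewrite -lt0n.
Qed.

Lemma theta_bound_lovasz (V : finType) (G : graph V) (C : {set V}) :
  (0 < #|V|)%N -> independent G C -> theta_bound G (#|C|%:R : R) ->
  is_lovasz_theta G (#|C|%:R : R).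
Proof.
move=> /card_gt0P[v0 _] Cind [I [i0 [q [q1 qt q0]]]].
set t : R := #|C|%:R in qt *.
have t1 : 1 <= t.
  apply: le_trans (qt v0); rewrite (bigD1 i0) //= q1 expr1n lerDl sumr_ge0 //.
  by move=> i _; apply: sqr_ge0.
have t0 : 0 < t by apply: lt_le_trans t1.
(* The indicator vector of [C] is both an eigenvector of the optimal matrix and the test vector for
   the lower bound. *)
pose w : 'rV[R]_#|V| := \row_i (enum_val i \in C)%:R.
have sumC (F : V -> R) :
    \sum_(i < #|V|) (enum_val i \in C)%:R * F (enum_val i)
    = \sum_(v in C) F v.
  rewrite [RHS]big_mkcond (reindex _ (onW_bij _ (@enum_val_bij V))) /=.
  by apply: eq_bigr => i _; case: ifP; rewrite ?mul1r ?mul0r.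
have sum1 : \sum_(v in C) (1 : R) = t by rewrite sumr_const.
have wn0 : w != 0.
  apply/eqP => /rowP w0; have := sumC (fun=> 1); rewrite sum1 => E.
  move: t0; rewrite -E big1 ?ltxx // => i _; have := w0 i.
  by rewrite !mxE => ->; rewrite mul0r.
have wsq : \sum_i w 0 i ^+ 2 = t.
  rewrite -sum1 -sumC; apply: eq_bigr => i _; rewrite mxE.
  by case: (_ \in _); rewrite ?expr1n ?expr0n ?mul1r ?mul0r.
split.
  (* The optimal matrix is J - B with its diagonal reset to 1; then t I - A is the Gram matrix of
     the coordinates other than [i0] plus a nonnegative diagonal. *)
  pose B u v := \sum_i q i u * q i v.
  pose A : 'M[R]_#|V| :=
    \matrix_(i, j) if i == j then 1 else 1 - B (enum_val i) (enum_val j).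
  have Bsym u v : B u v = B v u by apply: eq_bigr => i _; rewrite mulrC.
  exists A.
    split; first by apply/matrixP => i j; rewrite !mxE eq_sym Bsym.
    move=> i j; rewrite mxE; case: eqVneq => //= ij nadj.
    by rewrite /B q0 ?subr0 // (inj_eq enum_val_inj).
  (* B has trace at most t^2 on C, while the coordinate i0 alone contributes
     t^2 to the sum of the entries of B on C: the other coordinates vanish. *)
  have qC i : i != i0 -> \sum_(v in C) q i v = 0.
    move=> ii0; apply/eqP; rewrite -sqrf_eq0; apply/eqP; move: i ii0.
    apply: psumr_eq0P => [i _|]; first exact: sqr_ge0.
    apply/eqP; rewrite eq_le sumr_ge0 ?andbT => [|i _]; last exact: sqr_ge0.
    have := sum_sqr_independent Cind q0; rewrite (bigD1 i0) //=.
    under [X in X ^+ 2]eq_bigr do rewrite q1.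
    have : \sum_(v in C) \sum_i q i v ^+ 2 <= t ^+ 2.
      rewrite (le_trans (ler_sum _ (fun v _ => qt v))) //.
      by rewrite sumr_const -/t -mulr_natr.
    by rewrite sum1; lra.
  have BC v : \sum_(u in C) B u v = t.
    rewrite exchange_big (bigD1 i0) //= [X in _ + X]big1 ?addr0 => [|i ii0].
      by rewrite -mulr_suml q1 mulr1; under eq_bigr do rewrite q1.
    by rewrite -mulr_suml qC ?mul0r.
  have Bdiag v : v \in C -> B v v = t.
    move=> vC; rewrite -(BC v) (bigD1 v) //= [X in _ + X]big1 ?addr0 //.
    move=> u /andP[uC uv].
    by rewrite /B q0 // (independentP _ _ Cind).
  split.
    (* J - B contributes t - t = 0, and the diagonal correction contributes [B v v] = t exactly when
       [v] lies in [C]. *)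
    apply/eigenvalueP; exists w => //; apply/rowP => j.
    rewrite !mxE; set v := enum_val j.
    transitivity (\sum_(i < #|V|) (enum_val i \in C)%:R * (1 - B (enum_val i) v)
                  + (v \in C)%:R * B v v).
      rewrite (bigD1 j) // [X in _ = X + _](bigD1 j) //= !mxE eqxx -/v addrAC.
      congr (_ + _); first by ring.
      by apply: eq_bigr => i /negPf ij; rewrite !mxE ij.
    rewrite (sumC (fun u => 1 - B u v)) sumrB sum1 BC subrr add0r.
    by case: (boolP (v \in C)) => [/Bdiag->|_]; rewrite ?mul1r ?mulr1 ?mul0r ?mulr0.
  move=> a /eigenvalueP[y yE y0]; rewrite -(ler_pM2r (sum_sqr_gt0 y0)).
  rewrite -(qform_eigenvector yE).
  have : qform A (y 0) +
      (qform (fun i j => \sum_k (k != i0)%:R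
                                  * (q k (enum_val i) * q k (enum_val j))) (y 0)
       + qform (fun i j => (i == j)%:R * (t - B (enum_val i) (enum_val i))) (y 0))
      = qform (fun i j => (i == j)%:R * t) (y 0).
    rewrite -!qformD; apply: eq_qform => i j; rewrite mxE.
    have -> : \sum_k (k != i0)%:R * (q k (enum_val i) * q k (enum_val j))
              = B (enum_val i) (enum_val j) - 1.
      rewrite /B (bigD1 i0) // [X in _ = X - _](bigD1 i0) //= eqxx !q1 mul0r add0r.
      rewrite mulr1 addrAC subrr add0r; apply: eq_bigr => k ->; exact: mul1r.
    by case: eqVneq => [->|_] /=; ring.
  rewrite qform_gram !qform_diag -mulr_sumr => <-; rewrite lerDl addr_ge0 //.
    by apply: sumr_ge0 => k _; rewrite mulr_ge0 ?ler0n ?sqr_ge0.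
  apply: sumr_ge0 => i _; rewrite mulr_ge0 ?sqr_ge0 // subr_ge0 /B.
  by under eq_bigr do rewrite -expr2.
(* A feasible matrix is 1 on C x C, so its form at [w] is t^2, while [w] has squared length t; hence
   t^2 <= m t. *)
move=> A m [Asym A1] mmax.
have := max_eigenvalue_psd Asym mmax (w 0).
rewrite (_ : qform _ _ = qform (fun i j => (i == j)%:R * m) (w 0)
                         + -1 * qform (fun i j => 1) (w 0)); last first.
  rewrite -qformZ -qformD; apply: eq_bigr => i _; apply: eq_bigr => j _.
  rewrite !mxE; case: (boolP (_ \in C)) => iC; last by rewrite mul0r !mulr0.
  case: (boolP (_ \in C)) => jC; last by rewrite !mulr0.
  by rewrite A1 ?mulN1r // (independentP _ _ Cind) ?orbT.
rewrite qform_diag -mulr_sumr wsq.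
have -> : qform (fun i j => 1) (w 0) = t ^+ 2.
  rewrite -{1}sum1 -sumC sqr_sum; apply: eq_bigr => i _; apply: eq_bigr => j _.
  by rewrite !mxE !mulr1 mul1r.
by rewrite mulN1r subr_ge0 expr2 ler_pM2r.
Qed.

Lemma theta_bound_of_psd (V : finType) (G : graph V) (C : {set V})
    (P : V -> V -> R) (c : R) : independent G C -> 0 < c -> (0 < #|V|)%N ->
  (forall u v, P u v = P v u) -> psd P ->
  (forall u v, u != v -> ~~ adj G u v -> P u v = 0) ->
  (forall v, P v v <= c) ->
  (forall v, v \in C -> P v v = c) ->
  (forall v, v \notin C -> \sum_(u in C) P v u = c) ->
  theta_bound G (#|C|%:R : R).
Proof.
move=> /independentP Cind c0 /card_gt0P[v0 _] Psym Ppsd P0 Pc Pin Pout.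
have PC v : \sum_(u in C) P v u = c.
  have [vC|] := boolP (v \in C); last exact: Pout.
  rewrite (bigD1 v) //= Pin // big1 ?addr0 // => u /andP[uC uv].
  by rewrite P0 ?Cind // eq_sym.
have [I [g gE]] := psd_gram Psym Ppsd.
set t : R := #|C|%:R.
have t0 : 0 < t.
  (* An empty [C] would make the row sum at [v0] zero instead of [c]. *)
  rewrite ltr0n card_gt0; apply/eqP => C0.
  by have := PC v0; rewrite C0 big_set0 => E; rewrite -E ltxx in c0.
(* As [h] has inner product c with every Gram vector and squared length c t, subtracting h / t
   projects a Gram vector orthogonally to [h]. *)
pose h i := \sum_(u in C) g i u.
have hg v : \sum_i h i * g i v = c.
  rewrite -(PC v); under eq_bigr do rewrite mulr_suml.
  by rewrite exchange_big; apply: eq_bigr => u _; rewrite Psym gE.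
have hh : \sum_i h i ^+ 2 = c * t.
  under eq_bigr => i _ do rewrite expr2 {2}/h mulr_sumr.
  by rewrite exchange_big /=; under eq_bigr do rewrite hg; rewrite sumr_const mulr_natr.
(* With this scaling, the projected vectors extended by a constant coordinate 1 (at index [None])
   have Gram matrix (t / c) P. *)
pose s := Num.sqrt (t / c).
have ss : s ^+ 2 = t / c by rewrite sqr_sqrtr // divr_ge0 // ltW.
have E u v : 1 * 1 + \sum_i (s * (g i u - h i / t)) * (s * (g i v - h i / t))
             = t / c * P u v.
  rewrite (eq_bigr (fun i => t / c * (g i u * g i v) - c^-1 * (h i * g i u)
                      - c^-1 * (h i * g i v) + (c * t)^-1 * h i ^+ 2)).
    rewrite big_split /= !sumrB -!mulr_sumr !hg hh gE; field.
    by rewrite !gt_eqF.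
  move=> i _; rewrite mulrACA -expr2 ss; field.
  by rewrite !gt_eqF.
exists (option I), None,
  (fun k v => if k is Some i then s * (g i v - h i / t) else 1).
have O (F : option I -> R) : \sum_k F k = F None + \sum_i F (Some i).
  rewrite (bigD1 None) //=; congr (_ + _).
  by rewrite (reindex_omap Some id) => [|[]//]; apply: eq_bigl => i; rewrite eqxx.
split=> // [v|u v uv nadj].
  under eq_bigr do rewrite expr2.
  rewrite O E -[leRHS]mulr1 -mulrA ler_pM2l // mulrC ler_pdivrMr // mul1r.
  exact: Pc.
by rewrite O E P0 // mulr0.
Qed.

End Certificates.

(** * Positive semidefinite matrices attached to a graph *)

(** A zero diagonal entry means a zero Gram vector. This later forces the constant [c] to be
    positive. *)
Lemma psd_diag_eq0 (R : rcfType) (V : finType) (P : V -> V -> R) u v :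
  (forall u v, P u v = P v u) -> psd P -> P v v = 0 -> P u v = 0.
Proof.
move=> Psym /(psd_gram Psym)[I [g gE]].
rewrite gE => /(psumr_eq0P (fun i _ => sqr_ge0 _)) g0.
rewrite gE big1 // => i _; suff -> : g i v = 0 by rewrite mulr0.
by apply/eqP; rewrite -sqrf_eq0 g0.
Qed.

Lemma psd_enum (R : rcfType) (V : finType) (P : V -> V -> R) :
  psd (fun i j : 'I_#|V| => P (enum_val i) (enum_val j)) -> psd P.
Proof. by move=> H x; rewrite qform_enum; apply: H. Qed.

Lemma eq_psd (R : rcfType) (T : finType) (P Q : T -> T -> R) :
  P =2 Q -> psd P -> psd Q.
Proof. by move=> E H x; rewrite -(eq_qform x E). Qed.

(* Twice the quadratic form is the sum of the squares w u v (x u + s x v)^2;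
   s = -1 is the Laplacian of the weights w and s = 1 the signless one. *)
Lemma psd_signed_laplacian (R : rcfType) (V : finType) (w : V -> V -> R) (s : R) :
  (forall u v, w u v = w v u) -> (forall u v, 0 <= w u v) -> s ^+ 2 = 1 ->
  psd (fun u v => (u == v)%:R * (\sum_z w u z) + s * w u v).
Proof.
move=> wsym w0 s1 x; rewrite -(pmulr_rge0 _ (ltr0Sn R 1)).
suff -> : 2 * qform (fun u v => (u == v)%:R * (\sum_z w u z) + s * w u v) x
    = \sum_u \sum_v w u v * (x u + s * x v) ^+ 2.
  by do 2![apply: sumr_ge0 => ? _]; rewrite mulr_ge0 ?sqr_ge0.
rewrite qformD qform_diag qformZ.
have E : \sum_u (\sum_z w u z) * x u ^+ 2 = \sum_u \sum_v w u v * x u ^+ 2.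
  by apply: eq_bigr => u _; rewrite mulr_suml.
have E' : \sum_u (\sum_z w u z) * x u ^+ 2 = \sum_u \sum_v w u v * x v ^+ 2.
  rewrite E exchange_big /=; apply: eq_bigr => u _; apply: eq_bigr => v _.
  by rewrite wsym.
rewrite mulrDr [X in X + _]mulr_natl mulr2n {1}E E' /qform mulrA mulr_sumr -!big_split.
apply: eq_bigr => u _ /=; rewrite mulr_sumr -!big_split; apply: eq_bigr => v _ /=.
by rewrite sqrrD exprMn s1; ring.
Qed.

Lemma leq_bigminn (T : finType) (n : nat) (F : T -> nat) v :
  (\big[minn/n]_(u : T) F u <= F v)%N.
Proof.
have := mem_index_enum v; elim: (index_enum T) => // u s IH.
rewrite in_cons big_cons geq_min => /predU1P[->|/IH->]; last by rewrite orbT.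
by rewrite leqnn.
Qed.

Lemma min_degree_le (V : finType) (G : graph V) v : (min_degree G <= degree G v)%N.
Proof. exact: leq_bigminn. Qed.

Lemma sum_adj (R : pzRingType) (V : finType) (G : graph V) (C : {set V}) v :
  \sum_(u in C) (adj G v u)%:R = (nbrs_in G C v)%:R :> R.
Proof.
rewrite /nbrs_in -sum1_card natr_sum big_mkcond [RHS]big_mkcond /=.
by apply: eq_bigr => u _; rewrite inE; case: (u \in C); case: (adj _ _ _).
Qed.

Lemma degreeE (V : finType) (G : graph V) v : degree G v = nbrs_in G setT v.
Proof. by apply: eq_card => u; rewrite !inE. Qed.

Lemma sum_adjT (R : pzRingType) (V : finType) (G : graph V) v :
  \sum_u (adj G v u)%:R = (degree G v)%:R :> R.
Proof. by rewrite degreeE -sum_adj; apply: eq_bigl => u; rewrite inE. Qed.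

Lemma adjacency_psd (R : realType) (V : finType) (G : graph V) (tau : R) :
  min_eigenvalue (adjacency_mx R G) tau ->
  psd (fun u v => (adj G u v)%:R - (u == v)%:R * tau).
Proof.
move=> mtau; have Asym : (adjacency_mx R G)^T = adjacency_mx R G.
  by apply/matrixP => i j; rewrite !mxE adj_sym.
apply: psd_enum; apply: eq_psd (min_eigenvalue_psd Asym mtau) => i j.
by rewrite mxE (inj_eq enum_val_inj).
Qed.

(** The positive semidefinite matrix A - tau I has diagonal entries -tau, as there are no loops. *)
Lemma adjacency_min_eigenvalue_le0 (R : realType) (V : finType) (G : graph V)
    (tau : R) : (0 < #|V|)%N -> min_eigenvalue (adjacency_mx R G) tau -> tau <= 0.
Proof.
move=> /card_gt0P[v _] /adjacency_psd/(psd_diag_ge0 v).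
by rewrite adj_irr eqxx mul1r sub0r oppr_ge0.
Qed.

Lemma laplacian_psd (R : realType) (V : finType) (G : graph V) (mu : R) :
  max_eigenvalue (laplacian_mx R G) mu ->
  psd (fun u v => (u == v)%:R * (mu - (degree G u)%:R) + (adj G u v)%:R).
Proof.
move=> mmu; have Lsym : (laplacian_mx R G)^T = laplacian_mx R G.
  apply/matrixP => i j; rewrite !mxE adj_sym.
  by case: (eqVneq j i) => [->|ij]; rewrite ?eqxx // eq_sym (negPf ij).
apply: psd_enum; apply: eq_psd (max_eigenvalue_psd Lsym mmu) => i j.
rewrite !mxE (inj_eq enum_val_inj) -mulr_natl; case: eqVneq => [->|_] /=; ring.
Qed.

(* The sum of the Laplacians of G and of its complement is n I - J. *)
Lemma complement_laplacian_psd (R : realType) (V : finType) (G : graph V) :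
  psd (fun u v => (u == v)%:R * (#|V|%:R - (degree G u)%:R) + (adj G u v)%:R : R).
Proof.
pose w u v : R := (~~ adj G u v)%:R.
have wE u v : w u v = 1 - (adj G u v)%:R.
  by rewrite /w; case: (adj _ _ _); rewrite /= ?subrr ?subr0.
have L : psd (fun u v => (u == v)%:R * (\sum_z w u z) + -1 * w u v).
  by apply: psd_signed_laplacian => [u v|u v|]; rewrite ?sqrrN ?expr1n // /w 1?adj_sym.
move=> x; rewrite (_ : qform _ x =
    qform (fun u v => (u == v)%:R * (\sum_z w u z) + -1 * w u v) x + (\sum_u x u) ^+ 2).
  by rewrite addr_ge0 ?sqr_ge0.
have -> : (\sum_u x u) ^+ 2 = qform (fun _ _ => 1) x.
  rewrite sqr_sum; apply: eq_bigr => u _; apply: eq_bigr => v _; exact/esym/mul1r.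
rewrite -qformD; apply: eq_qform => u v.
have -> : \sum_z w u z = #|V|%:R - (degree G u)%:R.
  by under eq_bigr do rewrite wE; rewrite sumrB sumr_const sum_adjT.
by rewrite wE; ring.
Qed.

(** For the normalized Laplacian L, the congruence D^(1/2) (mu I - L) D^(1/2) = (mu - 1) D + A
    clears the square roots. *)
Lemma normalized_laplacian_psd (R : realType) (V : finType) (G : graph V) (mu : R) :
  (forall v, 0 < degree G v)%N ->
  max_eigenvalue (normalized_laplacian_mx R G) mu ->
  psd (fun u v => (u == v)%:R * ((mu - 1) * (degree G u)%:R) + (adj G u v)%:R).
Proof.
move=> d0 mmu.
have Lsym : (normalized_laplacian_mx R G)^T = normalized_laplacian_mx R G.
  by apply/matrixP => i j; rewrite !mxE eq_sym adj_sym mulrC.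
pose s v : R := Num.sqrt (degree G v)%:R.
have ss v : s v ^+ 2 = (degree G v)%:R by rewrite sqr_sqrtr.
have s0 v : s v != 0 by rewrite gt_eqF // sqrtr_gt0 ltr0n.
pose M u v : R := (u == v)%:R * (mu - 1) + (adj G u v)%:R / (s u * s v).
have Mpsd : psd M.
  apply: psd_enum; apply: eq_psd (max_eigenvalue_psd Lsym mmu) => i j.
  rewrite !mxE /M (inj_eq enum_val_inj); case: eqVneq => [->|_] /=.
    by rewrite adj_irr mul0r; ring.
  by case: (adj _ _ _); rewrite /= ?sqrtrM //; ring.
apply: eq_psd (psd_scale s Mpsd) => u v; rewrite /M mulrDr; congr (_ + _).
  by case: eqVneq => [->|_] /=; rewrite -?ss; ring.
by field; rewrite !s0.
Qed.

(** Double counting of adjacent pairs; the cast to [int] lets [sum_adj] turn counts into sums of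
    matrix entries. *)
Lemma sum_nbrs_in_exchange (V : finType) (G : graph V) (A B : {set V}) :
  (\sum_(v in A) nbrs_in G B v = \sum_(u in B) nbrs_in G A u)%N.
Proof.
apply/eqP; rewrite -(eqr_nat int) !natr_sum.
under eq_bigr do rewrite -sum_adj; under [X in _ == X]eq_bigr do rewrite -sum_adj.
rewrite exchange_big; apply/eqP/eq_bigr => u _; apply: eq_bigr => v _.
by rewrite adj_sym.
Qed.

(** * Certificates for the families of conditions *)

Section Cases.
Variables (R : realType) (V : finType) (G : graph V) (C : {set V}).
Hypotheses (V0 : (0 < #|V|)%N) (Cind : independent G C).

Let bound := theta_bound G (#|C|%:R : R).

(** A + lambda I = (A - tau I) + (lambda + tau) I. The weak inequality covers both lambda > -tau and
    lambda = -tau. *)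
Lemma theta_bound_adjacency (tau lambda : R) :
  min_eigenvalue (adjacency_mx R G) tau -> - tau <= lambda -> 0 < lambda ->
  (forall v, v \notin C -> (nbrs_in G C v)%:R = lambda) -> bound.
Proof.
move=> /adjacency_psd Apsd tl l0 Cout.
apply: (@theta_bound_of_psd _ _ _ _
  (fun u v => (adj G u v)%:R + (u == v)%:R * lambda) lambda) => //.
- by move=> u v; rewrite adj_sym eq_sym.
- move=> x; rewrite (_ : qform _ _ =
    qform (fun u v => (adj G u v)%:R - (u == v)%:R * tau) x
    + qform (fun u v => (u == v)%:R * (lambda + tau)) x).
    rewrite addr_ge0 // qform_diag sumr_ge0 // => u _.
    by rewrite mulr_ge0 ?sqr_ge0 //; lra.
  by rewrite -qformD; apply: eq_qform => u v; ring.
- by move=> u v /negPf-> /negPf->; rewrite mul0r addr0.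
- by move=> v; rewrite adj_irr eqxx mul1r add0r.
- by move=> v _; rewrite adj_irr eqxx mul1r add0r.
- move=> v vC; rewrite big_split /= sum_adj Cout // big1 ?addr0 // => u uC.
  by case: eqVneq => [vu|]; rewrite ?mul0r //; rewrite vu uC in vC.
Qed.

(** General in [mu] and [k] so as to serve both the largest Laplacian eigenvalue and mu = |V|. *)
Lemma theta_bound_laplacian (mu : R) (k : nat) : 0 < mu ->
  psd (fun u v => (u == v)%:R * (mu - (degree G u)%:R) + (adj G u v)%:R) ->
  (forall v, k <= degree G v)%N -> (forall v, v \in C -> degree G v = k) ->
  (forall v, v \notin C -> (nbrs_in G C v)%:R = mu - k%:R) -> bound.
Proof.
set P := (fun u v => _) => mu0 Ppsd kle Cdeg Cout.
have Psym u v : P u v = P v u.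
  by rewrite /P adj_sym eq_sym; case: eqVneq => [->|_]; rewrite ?mul0r.
have Pdiag v : P v v = mu - (degree G v)%:R by rewrite /P eqxx mul1r adj_irr addr0.
have Ple v : P v v <= mu - k%:R by rewrite Pdiag lerD2l lerN2 ler_nat.
apply: (@theta_bound_of_psd _ _ _ _ P (mu - k%:R)) => //.
(* If mu - k <= 0, all diagonal entries vanish, hence all entries; then [G] has no edges and the
   diagonal entry is mu itself, so mu = 0. *)
- rewrite ltNge; apply/negP => c0; have /card_gt0P[v _] := V0.
  have P0 u : P u u = 0.
    by apply: le_anti; rewrite psd_diag_ge0 // (le_trans (Ple u) c0).
  suff d0 : degree G v = 0%N by have := P0 v; rewrite Pdiag d0; lra.
  apply: eq_card0 => u; rewrite inE; apply/negP => vu.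
  have := psd_diag_eq0 v Psym Ppsd (P0 u); rewrite /P vu.
  case: eqVneq vu => [->|_ _]; first by rewrite adj_irr.
  by rewrite mul0r add0r => /eqP; rewrite oner_eq0.
- by move=> u v /negPf uv /negPf nadj; rewrite /P uv nadj mul0r addr0.
- by move=> v vC; rewrite Pdiag Cdeg.
- move=> v vC; rewrite big_split /= sum_adj Cout // big1 ?add0r // => u uC.
  by case: eqVneq => [vu|]; rewrite ?mul0r //; rewrite vu uC in vC.
Qed.

(** The matrix is built from [H], and edges of [H] are edges of [G], so it vanishes at distinct
    nonadjacent pairs of [G]. Taking H = G serves the normalized Laplacian, mu = 2 the semiregular
    subgraph. *)
Lemma theta_bound_normalized_laplacian (H : graph V) (mu : R) (k : nat) :
  spanning_subgraph H G -> (0 < k)%N ->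
  psd (fun u v => (u == v)%:R * ((mu - 1) * (degree H u)%:R) + (adj H u v)%:R) ->
  (forall v, k <= degree H v)%N -> (forall v, v \in C -> degree H v = k) ->
  (forall v, v \notin C -> (nbrs_in H C v)%:R = (mu - 1) * (degree H v)%:R) ->
  bound.
Proof.
set P := (fun u v => _) => HG k0 Ppsd kle Cdeg Cout.
have d0 v : 0 < (degree H v)%:R :> R by rewrite ltr0n (leq_trans k0).
have kpos : 0 < k%:R :> R by rewrite ltr0n.
have Psym u v : P u v = P v u.
  by rewrite /P adj_sym eq_sym; case: eqVneq => [->|_]; rewrite ?mul0r.
have Pdiag v : P v v = (mu - 1) * (degree H v)%:R.
  by rewrite /P eqxx mul1r adj_irr addr0.
have /card_gt0P[v0 _] := V0.
(* Otherwise the diagonal vanishes and [H] has no edges, against its positive degrees. *)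
have mu1 : 0 < mu - 1.
  rewrite ltNge; apply/negP => c0.
  have P0 u : P u u = 0.
    apply: le_anti; rewrite psd_diag_ge0 // Pdiag andbT.
    by rewrite -(mul0r (degree H u)%:R) ler_wpM2r // ltW.
  suff dz : degree H v0 = 0%N by have := d0 v0; rewrite dz ltxx.
  apply: eq_card0 => u; rewrite inE; apply/negP => vu.
  have := psd_diag_eq0 v0 Psym Ppsd (P0 u); rewrite /P vu.
  case: eqVneq vu => [->|_ _]; first by rewrite adj_irr.
  by rewrite mul0r add0r => /eqP; rewrite oner_eq0.
(* Scaling by D^-1 makes the diagonal (mu - 1) / d_v, at most (mu - 1) / k, and removes d_v from the
   row sums outside [C]. *)
pose s v : R := (degree H v)%:R^-1.
have diagE v : s v * s v * P v v = (mu - 1) / (degree H v)%:R.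
  by rewrite Pdiag /s; field; rewrite gt_eqF.
apply: (@theta_bound_of_psd _ _ _ _ (fun u v => s u * s v * P u v)
  ((mu - 1) / k%:R)) => //.
- by rewrite divr_gt0.
- by move=> u v; rewrite Psym [s u * _]mulrC.
- exact: psd_scale.
- move=> u v /negPf uv /negPf nadj; rewrite /P uv.
  case: (boolP (adj H u v)) => [/HG|_]; first by rewrite nadj.
  by rewrite mul0r addr0 mulr0.
- by move=> v; rewrite diagE ler_pM2l // lef_pV2 ?posrE // ler_nat.
- by move=> v vC; rewrite diagE Cdeg.
- move=> v vC; rewrite (eq_bigr (fun u => s v / k%:R * (adj H v u)%:R)).
    rewrite -mulr_sumr sum_adj Cout // /s; field.
    by rewrite !gt_eqF.
  move=> u uC; rewrite /P /s (Cdeg _ uC).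
  by case: eqVneq => [vu|]; rewrite ?mul0r ?add0r //; rewrite vu uC in vC.
Qed.

(** Row [v] of N N^T summed over [C] counts the indices incident with [v], since each of them meets
    [C] once; scaling by D^-1 turns this into 1 / k. The last hypothesis concerns only indices
    incident with some vertex, so empty ones may occur. *)
Lemma theta_bound_incidence (I : finType) (m : I -> V -> bool) (k : nat) :
  (forall i u v, m i u -> m i v -> u != v -> adj G u v) ->
  (0 < k)%N -> (forall v, k <= #|[set i | m i v]|)%N ->
  (forall v, v \in C -> #|[set i | m i v]| = k) ->
  (forall i v, m i v -> #|[set u in C | m i u]| = 1%N) -> bound.
Proof.
move=> mclique k0 kle Cdeg C1.
pose d v : R := #|[set i | m i v]|%:R.
have d0 v : 0 < d v by rewrite ltr0n (leq_trans k0).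
have kpos : 0 < k%:R :> R by rewrite ltr0n.
pose B u v : R := \sum_i 1 * ((m i u)%:R * (m i v)%:R).
have dE v : d v = \sum_i (m i v)%:R.
  rewrite /d -sum1_card natr_sum big_mkcond; apply: eq_bigr => i _.
  by rewrite inE; case: (m i v).
have Bdiag v : B v v = d v.
  by rewrite dE; apply: eq_bigr => i _; case: (m i v); rewrite ?mulr0 ?mulr1.
have diagE v : (d v)^-1 * (d v)^-1 * B v v = (d v)^-1.
  by rewrite Bdiag -mulrA mulVf ?mulr1 // gt_eqF.
apply: (@theta_bound_of_psd _ _ _ _ (fun u v => (d u)^-1 * (d v)^-1 * B u v)
  k%:R^-1) => //.
- by rewrite invr_gt0.
- move=> u v; rewrite [_ / d v]mulrC; congr (_ * _).
  by apply: eq_bigr => i _; rewrite [X in 1 * X]mulrC.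
- apply: psd_scale => x; rewrite qform_gram; apply: sumr_ge0 => i _.
  by rewrite mul1r sqr_ge0.
- move=> u v uv nadj; rewrite /B big1 ?mulr0 // => i _.
  case: (boolP (m i u)) => iu; last by rewrite mul0r mulr0.
  case: (boolP (m i v)) => iv; last by rewrite !mulr0.
  by rewrite (mclique _ _ _ iu iv uv) in nadj.
- by move=> v; rewrite diagE lef_pV2 ?posrE // ler_nat.
- by move=> v vC; rewrite diagE /d Cdeg.
- move=> v _; rewrite (eq_bigr (fun u => (d v)^-1 / k%:R * B v u)); last first.
    by move=> u uC; rewrite /d (Cdeg _ uC).
  rewrite -mulr_sumr exchange_big /= (_ : (\sum_i _) = d v); last first.
    rewrite dE; apply: eq_bigr => i _; rewrite -mulr_sumr mul1r -mulr_sumr.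
    case: (boolP (m i v)) => iv; last by rewrite mul0r.
    rewrite mul1r -[RHS](congr1 (fun n => n%:R) (C1 _ _ iv)) -sum1_card natr_sum.
    rewrite big_mkcond [RHS]big_mkcond; apply: eq_bigr => u _.
    by rewrite inE; case: (u \in C); case: (m i u).
  by rewrite mulrAC mulVf ?mul1r // gt_eqF.
Qed.

End Cases.

(** * Degrees under vertex deletion, and the case analysis *)

Lemma card_nbrs_split (V : finType) (G : graph V) (C : {set V}) v :
  degree G v = (nbrs_in G C v + nbrs_in G (~: C) v)%N.
Proof.
rewrite /degree -(cardsID C); congr (_ + _)%N; apply: eq_card => u;
  by rewrite !inE andbC.
Qed.

Lemma degree_delete (V : finType) (G : graph V) (C : {set V})
    (v : {v | v \in ~: C}) :
  degree (delete G C) v = nbrs_in G (~: C) (val v).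
Proof.
rewrite /degree /nbrs_in -(card_imset _ val_inj); apply: eq_card => u.
rewrite [RHS]inE; apply/imsetP/andP => [[x]|[uC vu]].
  by rewrite inE => vx ->; split=> //; apply: valP.
by exists (exist _ u uC); rewrite ?inE.
Qed.

Theorem theorem7p1 (R : realType) (V : finType) (V_nonempty : (0 < #|V|)%N)
  (G : graph V) (C : {set V}) (C_independent : independent G C) :
  (* (1) *)
  (exists (tau : R) (lambda : nat),
     [/\ min_eigenvalue (adjacency_mx R G) tau,
         - tau < lambda%:R
       & forall v, v \notin C -> nbrs_in G C v = lambda]) \/
  (* (2) *)
  (regular G /\
   exists tau : R,
     [/\ min_eigenvalue (adjacency_mx R G) tau,
         tau < 0
       & forall v, v \notin C -> (nbrs_in G C v)%:R = - tau]) \/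
  (* (3) *)
  (exists mu : R,
     [/\ max_eigenvalue (laplacian_mx R G) mu,
         0 < mu,
         forall u, u \in C -> degree G u = min_degree G
       & forall v, v \notin C ->
           (nbrs_in G C v)%:R = mu - (min_degree G)%:R]) \/
  (* (4) *)
  (exists mu : R,
     [/\ max_eigenvalue (normalized_laplacian_mx R G) mu,
         (0 < min_degree G)%N,
         forall u, u \in C -> degree G u = min_degree G
       & forall v, v \notin C ->
           (nbrs_in G C v)%:R = (mu - 1) * (degree G v)%:R]) \/
  (* (5) *)
  ((forall v, v \notin C -> forall u, u \in C -> adj G v u) /\
   (#|V|%:R - (min_degree (delete G C))%:R <= 2 * #|C|%:R :> R)) \/
  (* (6) *)
  (exists (H : graph V) (V1 : {set V}) (n1 n2 r1 r2 : nat),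
     [/\ spanning_subgraph H G,
         (0 < min_degree H)%N,
         (n1 <= n2)%N
       & semiregular_bipartite H V1 C n1 n2 r1 r2]) \/
  (* (7) *)
  (exists eps : {set {set V}},
     [/\ clique_covering G eps,
         (0 < min_cover_degree eps)%N,
         forall v, v \in C -> cover_degree eps v = min_cover_degree eps
       & forall Q, Q \in eps -> #|C :&: Q| = 1%N]) \/
  (* (8) *)
  (exists (W : finType) (H : hypergraph W)
          (f : V -> {e : {set W} | e \in hedges H}),
     [/\ uniform H,
         graph_iso G (intersection_graph H) f
       & perfect_matching H [set val (f v) | v in C]]) ->
  [/\ alpha G = #|C|,
      is_shannon_capacity G (#|C|%:R : R)
    & is_lovasz_theta G (#|C|%:R : R)].
Proof.

move=> cases.
suff B : theta_bound G (#|C|%:R : R).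
  split; [exact: theta_bound_alpha B|exact: theta_bound_shannon|].
  exact: theta_bound_lovasz.
have degree_le := min_degree_le G.
case: cases => [[tau [lambda [mtau tl Cout]]]|].
  apply: (theta_bound_adjacency _ _ mtau (ltW tl)) => // [|v /Cout->//].
  by have := adjacency_min_eigenvalue_le0 V_nonempty mtau; lra.
case=> [[_ [tau [mtau t0 Cout]]]|].
  by apply: (theta_bound_adjacency _ _ mtau (lexx _)) => //; rewrite oppr_gt0.
case=> [[mu [mmu mu0 Cdeg Cout]]|].
  exact: (theta_bound_laplacian _ _ mu0 (laplacian_psd mmu) degree_le Cdeg Cout).
case=> [[mu [mmu d0 Cdeg Cout]]|].
  apply: (@theta_bound_normalized_laplacian _ _ _ _ _ _ G mu (min_degree G)) => //.
  by apply: normalized_laplacian_psd => // v; apply: leq_trans d0 _.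
case=> [[Cjoin Ccard]|].
  have CV : (#|C| <= #|V|)%N by apply: max_card.
  have Cout v : v \notin C -> nbrs_in G C v = #|C|.
    move=> vC; apply: eq_card => u; rewrite inE.
    by case: (boolP (u \in C)) => // uC; rewrite Cjoin.
  have Cin v : v \in C -> degree G v = (#|V| - #|C|)%N.
    move=> vC; rewrite -[in RHS](setCK C) -cardsCs; apply: eq_card => u.
    rewrite !inE; case: (boolP (u \in C)) => uC; last by rewrite adj_sym Cjoin.
    by apply/negbTE; apply: (independentP _ _ C_independent).
  (* Vertices of [C] are adjacent to exactly the vertices outside [C], so k = |V| - |C| and mu - k =
     |C|. *)
  apply: (@theta_bound_laplacian _ _ _ _ _ _ #|V|%:R (#|V| - #|C|)%N) => //.
  - by rewrite ltr0n.
  - exact: complement_laplacian_psd.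
  - move=> v; have [/Cin->//|vC] := boolP (v \in C).
    (* Outside [C] the degree is |C| plus the degree in G - C, which the bound on 2|C| makes at
       least |V| - |C|. *)
    rewrite (card_nbrs_split _ C) Cout //.
    have vC' : v \in ~: C by rewrite inE.
    have := min_degree_le (delete G C) (exist _ v vC').
    rewrite degree_delete /=; move: Ccard.
    rewrite lerBlDr -natrM -natrD ler_nat => VC dC.
    by rewrite leq_subLR addnA addnn -mul2n (leq_trans VC) // leq_add2l.
  - by move=> v vC; rewrite Cout // natrB // subKr.
case=> [[H [V1 [n1 [n2 [r1 [r2 [HG d0 n12 semi]]]]]]]|].
  have degH v : (0 < degree H v)%N := leq_trans d0 (min_degree_le H v).
  case: semi => [[V1C _] [/independentP V1ind /independentP CindH] [V1n Cn]].
  move=> V1deg Cdeg.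
  have V1E v : v \notin C -> v \in V1.
    by move=> vC; have := in_setT v; rewrite -V1C inE (negPf vC) orbF.
  have nbrs v : v \in V1 -> nbrs_in H C v = r1.
    move=> vV1; rewrite -(V1deg v vV1); apply: eq_card => u; rewrite !inE.
    case: (boolP (adj H v u)) => [vu|_]; last by rewrite andbF.
    rewrite andbT; apply/negPn/negP => /V1E uV1.
    by have := V1ind _ _ vV1 uV1; rewrite vu.
  have nbrs' v : v \in C -> nbrs_in H V1 v = r2.
    move=> vC; rewrite -(Cdeg v vC); apply: eq_card => u; rewrite !inE.
    case: (boolP (adj H v u)) => [vu|_]; last by rewrite andbF.
    rewrite andbT; apply/negPn/negP => uV1.
    have /CindH/(_ vC) : u \in C by apply: contraR uV1 => /V1E.
    by rewrite adj_sym vu.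
  (* Counting the edges of [H] from both sides; with n1 <= n2 this makes [r2] a lower bound for the
     degrees on [V1] too. *)
  have double : (n1 * r1 = n2 * r2)%N.
    rewrite -V1n -Cn -!sum_nat_const -(eq_bigr _ nbrs) -(eq_bigr _ nbrs').
    exact: sum_nbrs_in_exchange.
  have n2pos : (0 < n2)%N.
    have : (#|V| <= n1 + n2)%N by rewrite -V1n -Cn -cardsT -V1C cardsU leq_subr.
    lia.
  (* The degree of a vertex of [C] shows that [r2] is positive. *)
  have [u uC] : exists u, u \in C by apply/card_gt0P; rewrite Cn.
  apply: (@theta_bound_normalized_laplacian _ _ _ _ _ _ H 2 r2) => //.
  - by rewrite -(Cdeg u uC).
  - apply: eq_psd (psd_signed_laplacian (w := fun u v => (adj H u v)%:R)
                     (s := 1) _ _ _) => [x y|x y|x y|].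
    + by rewrite sum_adjT; ring.
    + by rewrite adj_sym.
    + by rewrite ler0n.
    + by rewrite expr1n.
  - move=> v; have [/Cdeg->//|/V1E vV1] := boolP (v \in C).
    rewrite V1deg // -(@leq_pmul2l n1) ?double ?leq_mul2r ?n12 ?orbT //.
    by rewrite -V1n; apply/card_gt0P; exists v.
  - by move=> v /V1E vV1; rewrite nbrs // V1deg //; ring.
case=> [[eps [[epsclique _] eps0 Cdeg C1]]|].
  (* All vertex sets serve as indices; those outside [eps] are incident with no vertex. *)
  apply: (@theta_bound_incidence _ _ _ _ _ _ _
    (fun Q v => (Q \in eps) && (v \in Q)) (min_cover_degree eps)) => //.
  - move=> Q u v /andP[Qe uQ] /andP[_ vQ] uv.
    exact: (implyP (forall_inP (forall_inP (epsclique Q Qe) u uQ) v vQ)).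
  - by move=> v; apply: leq_bigminn.
  - move=> Q v /andP[Qe _]; rewrite -(C1 Q Qe); apply: eq_card => u.
    by rewrite !inE Qe.
case=> [W [H [f [[r Hr] [fbij fadj] [_ Mtriv Mcover]]]]].
have edge v : val (f v) \in hedges H by apply: valP.
have kE v : #|[set w | w \in val (f v)]| = r by rewrite cardsE; apply: Hr.
(* The points of the hypergraph are the indices: hyperedges through a point form a clique, each
   vertex is incident with [r] points, and the matching covers each point exactly once. *)
apply: (@theta_bound_incidence _ _ _ _ _ _ _ (fun w v => w \in val (f v)) r) => //.
- move=> w u v wu wv uv; rewrite -fadj /= /intersection_rel.
  rewrite (inj_eq (bij_inj fbij)) uv /=.
  by apply/set0Pn; exists w; rewrite inE wu.
- have /card_gt0P[v _] := V_nonempty; rewrite -(Hr _ (edge v)) card_gt0.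
  by apply: contraNneq (hedges_nonempty H) => <-.
- by move=> v; rewrite kE.
- move=> w v _; have : w \in cover [set val (f v) | v in C] by rewrite Mcover inE.
  move=> /bigcupP[_ /imsetP[u uC ->] wu]; rewrite -(cards1 u); apply: eq_card => z.
  rewrite !inE; apply/andP/eqP => [[zC wz]|->//].
  apply: (bij_inj fbij); apply: val_inj; apply/eqP/negPn/negP => zu.
  have /trivIsetP/(_ _ _ (imset_f _ zC) (imset_f _ uC) zu) := Mtriv.
  by rewrite disjoints_subset => /subsetP/(_ w wz); rewrite inE wu.
Qed.
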